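(* Let $0\leq \beta < 1$ and $q = 1/(1-\beta)$. Let $f:\mathbb{Z} \to \mathbb{R}$ be a function of bounded variation such that $\widetilde{M}_{\beta}f \not\equiv \infty$. Then $$\big\|\big(\widetilde{M}_{\beta}f\big)'\big\|_{\ell^q(\mathbb{Z})} \leq 4^{1/q} \,\|f'\|_{\ell^1(\mathbb{Z})}.$$
   Context: For $0\le\beta<1$ and $f:\mathbb{Z}\to\mathbb{R}$, the one-dimensional discrete uncentered fractional maximal function is the $[0,\infty]$-valued function $$\widetilde{M}_{\beta}f(n) = \sup_{r,s \geq 0} \,\frac{1}{(r + s+1)^{1 - \beta}} \sum_{k = -r}^{s} |f(n +k)|,$$ where the supremum is over nonnegative integers $r,s$. For $g:\mathbb{Z}\to\mathbb{R}$ the discrete derivative is $g'(n)=g(n+1)-g(n)$, and $\|g\|_{\ell^p(\mathbb{Z})}=\big(\sum_{n\in\mathbb{Z}}|g(n)|^p\big)^{1/p}$ for $1\le p<\infty$. The function $f$ is of bounded variation if $\|f'\|_{\ell^1(\mathbb{Z})}<\infty$. *)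

(* Defs.v *)
From HB Require Import structures.
From mathcomp Require Import all_boot all_order all_algebra.
From mathcomp Require Import all_classical all_reals all_analysis.

Set Implicit Arguments.
Unset Strict Implicit.
Unset Printing Implicit Defensive.

Import Order.TTheory GRing.Theory Num.Theory.

Local Open Scope classical_set_scope.
Local Open Scope ring_scope.

(* The window [n - r, n + s] has r + s + 1 points; its point of rank i is
   n + k with k = i - r. *)
Definition frac_average (R : realType) (beta : R) (f : int -> R) (n : int)
    (r s : nat) : R :=
  (\sum_(i < (r + s).+1) `|f (n + (i%:Z - r%:Z))|)
    / (((r + s).+1)%:R `^ (1 - beta)).

Definition frac_maximal (R : realType) (beta : R) (f : int -> R) (n : int) :
    \bar R :=
  ereal_sup [set (frac_average beta f n rs.1 rs.2)%:E
            | rs in [set: nat * nat]].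

(* Extended-real valued, so as to apply to the maximal function as it stands;
   a value involving an infinite g n or g (n + 1) is always infinite, the
   library convention being +oo - +oo = -oo, and so makes every l^p norm +oo
   for 0 < p. *)
Definition discrete_deriv (R : realType) (g : int -> \bar R) (n : int) :
    \bar R :=
  (g (n + 1)%R - g n)%E.

Definition lp_norm (R : realType) (p : R) (g : int -> \bar R) : \bar R :=
  ((\esum_(n in [set: int]) (`|g n| `^ p)) `^ p^-1)%E.

Definition bounded_variationZ (R : realType) (f : int -> R) : Prop :=
  (lp_norm 1 (discrete_deriv (EFin \o f)) < +oo)%E.

(* Main.v *)
Require Import Defs.
From HB Require Import structures.
From mathcomp Require Import all_boot all_order all_algebra.
From mathcomp Require Import all_classical all_reals all_analysis.
From mathcomp Require Import zify ring lra.

(** Write [a = 1 - beta], so that [q = 1 / a], let [g = |f|], let [m] be the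
    maximal function and [V] the total variation of [f].  The value of a window
    (a finite interval of integers) [I] is [S(I) / |I|^a], where [S(I)] is the
    sum of [g] over [I]; [m n] is the supremum of the values of the windows
    containing [n].  By the reflection [n |-> - n] it suffices to bound the sum
    of [(m (n + 1) - m n)^q] over the points where [m] increases by [V^q]; the
    two monotonicity directions then give [2 V^q], which is at most [4 V^q].

    A single jump.  If [m n < m (n + 1)], then [m (n + 1)] is attained
    ([longest_max_window]), because the values of very long windows hardly
    depend on the point, and a window attaining it starts at [n + 1].  Adding
    the point [n] to this window, of length [k], gives
    [(m (n + 1) - m n) k^a <= V] ([jump_window_le]), hence
    [(m (n + 1) - m n)^q <= V^(q - 1) (m (n + 1) - m n) k^(a - 1)].

    A run.  Let [m] be nondecreasing on [[x, b]] with [m (b + 1) < m b].  By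
    concavity of [t |-> t^a], the longest window attaining [m (n + 1)] at a jump
    [n] of the run goes at least to [b] ([max_window_reach]): otherwise merging
    it with a window attaining the supremum at the point after its end would
    give a longer window of at least the same value.  At the last jump [n] of the run, the window stops
    exactly at [b], as [m (b + 1) < m b = m (n + 1)].  So its length [K] is a
    lower bound for the lengths of the windows of all jumps of the run, and the
    [q]-th powers telescope to at most [V^(q - 1) K^(a - 1) (m b - m x)].  Now
    [K^(a - 1) m b] is the average of [g] over the last window, whereas
    [K^(a - 1) m x] is at least the minimum of [g] on the run, since the whole
    run is a window of length at least [K].  Thus the run contributes at most
    [V^(q - 1)] times the variation of [g] on it ([rise_run_le]).

    The runs are disjoint, and a run that never ends contains no jump, because
    the longest window of a jump is finite; summing over the runs gives
    [V^(q - 1) V = V^q] ([sum_rise_le_power]). *)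

Import Order.TTheory GRing.Theory Num.Theory.

Set Implicit Arguments.
Unset Strict Implicit.
Unset Printing Implicit Defensive.

Local Open Scope ring_scope.

(** [lia] preceded by the removal of the hypotheses over the reals and of the
    quantified ones, whose translation dominates its running time. *)
Ltac int_lia :=
  try match goal with R : realType |- _ =>
    repeat match goal with H : ?P |- _ =>
      lazymatch P with
      | context [R] => clear H
      | forall _, _ => clear H
      | ex _ => clear H
      end
    end
  end; lia.

(** * Concavity of powers *)

Section PowerConcavity.
Context {R : realType}.
Implicit Types a t x y z : R.

(** The convexity of [t |-> t^(1/a)], read at [x^a] and [y^a]. *)
Lemma concave_powR a t x y : 0 < a -> a <= 1 -> 0 <= t -> t <= 1 ->
    0 <= x -> 0 <= y ->
  t * x `^ a + (1 - t) * y `^ a <= (t * x + (1 - t) * y) `^ a.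
Proof.
move=> a0 a1 t0 t1 x0 y0.
have ainv1 : 1 <= a^-1 by rewrite invf_ge1.
have inD z : 0 <= z ->
    z \in (`[0, +oo[%classic : classical_sets.set R).
  by move=> z0; rewrite inE/= in_itv/= z0.
have := @convex_powR R a^-1 ainv1 (Itv01 t0 t1) _ _
  (inD _ (powR_ge0 x a)) (inD _ (powR_ge0 y a)).
rewrite /= !convRE /= -!powRrM mulfV ?gt_eqF // !powRr1 //.
set u := t * _ + _; set v := t * _ + _ => uv.
have u0 : 0 <= u by rewrite addr_ge0// mulr_ge0 ?powR_ge0 ?subr_ge0.
have v0 : 0 <= v by rewrite addr_ge0// mulr_ge0 ?powR_ge0 ?subr_ge0.
have := ge0_ler_powR (ltW a0) (powR_ge0 u a^-1) v0 uv.
by rewrite -powRrM mulVf ?gt_eqF// powRr1.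
Qed.

(** Both [x + z] and [y] lie between [x] and [y + z], with complementary
    weights, so concavity bounds their powers from below by the same chord. *)
Lemma powR_increment_anti a x y z : 0 < a -> a <= 1 ->
    0 <= x -> x <= y -> 0 <= z ->
  (y + z) `^ a - y `^ a <= (x + z) `^ a - x `^ a.
Proof.
move=> a0 a1 x0 xy z0.
have [yzx|yzx] := leP (y + z) x.
  by have [-> ->] : y = x /\ z = 0 by split; lra.
have d0 : 0 < y + z - x by rewrite subr_gt0.
(* y is the mean of x and y + z with weights t and 1 - t, and x + z is the mean
   with the weights exchanged *)
pose t := z / (y + z - x).
have t0 : 0 <= t by rewrite divr_ge0 // ltW.
have t1 : t <= 1 by rewrite ler_pdivrMr // mul1r; lra.
have td : t * (y + z - x) = z by rewrite /t divfK // gt_eqF.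
have yz0 : 0 <= y + z by lra.
have t0' : 0 <= 1 - t by lra.
have t1' : 1 - t <= 1 by lra.
have := concave_powR a0 a1 t0 t1 x0 yz0.
have := concave_powR a0 a1 t0' t1' x0 yz0.
have -> : (1 - t) * x + (1 - (1 - t)) * (y + z) = x + z by rewrite -[in RHS]td; ring.
have -> : t * x + (1 - t) * (y + z) = y.
  have -> : t * x + (1 - t) * (y + z) = y + z - t * (y + z - x) by ring.
  by rewrite td; ring.
lra.
Qed.

End PowerConcavity.

(** * Sums over windows *)

Section WindowSums.
Context {R : realType}.
Implicit Types (h : int -> R) (l : int) (k : nat).

Definition wsum h l k : R := \sum_(i < k) h (l + i%:Z).

Lemma wsum0 h l : wsum h l 0 = 0.
Proof. by rewrite /wsum big_ord0. Qed.

Lemma wsum1 h l : wsum h l 1 = h l.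
Proof. by rewrite /wsum big_ord1 addr0. Qed.

Lemma wsum_cat h l j k : wsum h l (j + k) = wsum h l j + wsum h (l + j%:Z) k.
Proof.
rewrite /wsum big_split_ord /=; congr (_ + _).
by apply: eq_bigr => i _; rewrite PoszD addrA.
Qed.

Lemma wsum_ge0 h l k : (forall n, 0 <= h n) -> 0 <= wsum h l k.
Proof. by move=> h0; apply: sumr_ge0. Qed.

Lemma eq_wsum h1 h2 l k :
    (forall n, l <= n -> n < l + k%:Z -> h1 n = h2 n) ->
  wsum h1 l k = wsum h2 l k.
Proof. by move=> h12; apply: eq_bigr => i _; apply: h12; have := ltn_ord i; int_lia. Qed.

Lemma ler_wsum h1 h2 l k :
    (forall n, l <= n -> n < l + k%:Z -> h1 n <= h2 n) ->
  wsum h1 l k <= wsum h2 l k.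
Proof. by move=> h12; apply: ler_sum => i _; apply: h12; have := ltn_ord i; int_lia. Qed.

Lemma wsum_const (c : R) l k : wsum (fun=> c) l k = k%:R * c.
Proof. by rewrite /wsum sumr_const card_ord mulr_natl. Qed.

Lemma wsum_sub h l k l' k' : (forall n, 0 <= h n) ->
    l' <= l -> l + k%:Z <= l' + k'%:Z ->
  wsum h l k <= wsum h l' k'.
Proof.
move=> h0 ll' kk'.
have [i [j [-> ->]]] : exists i j : nat, l = l' + i%:Z /\ k' = (i + k + j)%N.
  exists (absz (l - l')%R), (absz (l' + k'%:Z - (l + k%:Z))%R); split; int_lia.
rewrite !wsum_cat.
by have := wsum_ge0 l' i h0;
  have := wsum_ge0 (l' + (i + k)%N%:Z) j h0; lra.
Qed.

Lemma wsum_telescope h l k :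
  wsum (fun n => h (n + 1) - h n) l k = h (l + k%:Z) - h l.
Proof.
elim: k => [|k IHk]; first by rewrite wsum0 addr0 subrr.
have -> : l + k.+1%:Z = l + k%:Z + 1 by int_lia.
by rewrite -addn1 wsum_cat wsum1 IHk; ring.
Qed.

Lemma wsumZ (c : R) h l k : wsum (fun n => c * h n) l k = c * wsum h l k.
Proof. by rewrite /wsum mulr_sumr. Qed.

Lemma wsum_reflect h l k :
  wsum (fun n => h (- n)) l k = wsum h (1 - l - k%:Z) k.
Proof.
rewrite /wsum (reindex_inj rev_ord_inj) /=; apply: eq_bigr => i _.
by congr (h _); have := ltn_ord i; int_lia.
Qed.

Definition increment h : int -> R := fun n => `|h (n + 1) - h n|.

Lemma increment_ge0 h n : 0 <= increment h n.
Proof. exact: normr_ge0. Qed.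

Lemma dist_le_wsum_increment h l k i j : (i <= k)%N -> (j <= k)%N ->
  h (l + i%:Z) - h (l + j%:Z) <= wsum (increment h) l k.
Proof.
have dist_le n d : `|h (n + d%:Z) - h n| <= wsum (increment h) n d.
  rewrite -wsum_telescope; exact: ler_norm_sum.
have mono n d : l <= n -> n + d%:Z <= l + k%:Z ->
    wsum (increment h) n d <= wsum (increment h) l k.
  by move=> ln nk; apply: wsum_sub => // p; exact: increment_ge0.
move=> ik jk; have [ji|ij] := leqP j i.
- have := dist_le (l + j%:Z) (i - j)%N.
  have -> : l + j%:Z + (i - j)%N%:Z = l + i%:Z by int_lia.
  move=> /(le_trans (ler_norm _)) /le_trans; apply; apply: mono; int_lia.
- have := dist_le (l + i%:Z) (j - i)%N.
  have -> : l + i%:Z + (j - i)%N%:Z = l + j%:Z by int_lia.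
  rewrite distrC => /(le_trans (ler_norm _)) /le_trans; apply; apply: mono; int_lia.
Qed.

(** The window that covers a point [n] covers [n0] after an extension by
    [|n - n0|] points on the side of [n0]. *)
Lemma extend_window (l n n0 : int) k (d := absz (n - n0)%R) :
    l <= n -> n < l + k%:Z ->
  exists l' : int, [/\ l' <= l, l' <= n0, n0 < l' + (k + d)%N%:Z &
    l + k%:Z <= l' + (k + d)%N%:Z].
Proof.
move=> ln nk; have [n0l|ln0] := leP n0 l.
- by exists (l - d%:Z); rewrite /d; split; lia.
- by exists l; rewrite /d; split; lia.
Qed.

End WindowSums.

(** * Attainment of the supremum over windows *)

(** The uncentered fractional maximal function with finite values: [m n] is the
    supremum of [wsum g l k / k^a] over the windows containing [n].  The
    quotients are cleared, so that the empty window needs no exception. *)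
Record window_sup {R : realType} (a : R) (g m : int -> R) : Prop := WindowSup {
  window_le : forall (l : int) k n, l <= n -> n < l + k%:Z ->
    wsum g l k <= m n * k%:R `^ a ;
  window_near : forall n c, c < m n ->
    exists (l : int) k, [/\ l <= n, n < l + k%:Z & c * k%:R `^ a < wsum g l k] }.

Lemma window_sup_reflect {R : realType} (a : R) (g m : int -> R) :
  window_sup a g m -> window_sup a (fun n => g (- n)) (fun n => m (- n)).
Proof.
move=> [gm_le gm_near]; split=> [l k n ln nk|n c /gm_near[l [k [ln nk ck]]]].
  rewrite wsum_reflect; apply: gm_le; int_lia.
exists (1 - l - k%:Z), k; split; [int_lia|int_lia|].
by rewrite wsum_reflect; congr (_ < wsum _ _ _) : ck; int_lia.
Qed.

Section FractionalSup.
Context {R : realType} (a : R) (g m : int -> R).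
Hypotheses (a_gt0 : 0 < a) (a_le1 : a <= 1).
Hypothesis g_ge0 : forall n, 0 <= g n.
Hypothesis gm : window_sup a g m.

Let pow_gt0 k : (0 < k)%N -> 0 < k%:R `^ a :> R.
Proof. by move=> k0; rewrite powR_gt0 // ltr0n. Qed.

Let window_sup_ge n : g n <= m n.
Proof.
have /(_ n (lexx _)) := window_le gm (l := n) (k := 1).
rewrite wsum1 powR1 mulr1; apply; int_lia.
Qed.

Let window_sup_ge0 n : 0 <= m n.
Proof. exact: le_trans (g_ge0 n) (window_sup_ge n). Qed.

(** Extending a long window by [d] points to reach [n0] costs only the factor
    [(k / (k + d))^a], which is close to 1.  So windows whose value at [n]
    exceeds [m n0] by a fixed margin have bounded length. *)
Lemma near_window_bounded (n0 n : int) c : m n0 < c ->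
  exists K, forall (l : int) k, l <= n -> n < l + k%:Z ->
    c * k%:R `^ a <= wsum g l k -> (k <= K)%N.
Proof.
move=> n0c; have c0 : 0 <= c := le_trans (window_sup_ge0 n0) (ltW n0c).
pose d := absz (n - n0)%R; pose q := a^-1.
have q0 : 0 < q by rewrite invr_gt0.
have gap : 0 < c `^ q - m n0 `^ q.
  by rewrite subr_gt0 gt0_ltr_powR // nnegrE.
(* B is the solution k of c^q k = (m n0)^q (k + d) *)
pose B := m n0 `^ q * d%:R / (c `^ q - m n0 `^ q).
have B0 : 0 <= B by rewrite divr_ge0 ?mulr_ge0 ?powR_ge0 ?(ltW gap).
exists (Num.truncn B) => l k ln nk ck.
have [l' [l'l l'n0 n0k lk]] := extend_window n0 ln nk.
have le_ext : wsum g l k <= m n0 * (k + d)%:R `^ a.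
  by apply: le_trans (window_le gm l'n0 n0k); exact: wsum_sub.
have := le_trans ck le_ext => {ck le_ext}.
move=> /(ge0_ler_powR (ltW q0)) /=.
rewrite !nnegrE !mulr_ge0 ?powR_ge0 // => /(_ isT isT).
rewrite !powRM ?powR_ge0 // -!powRrM mulfV ?gt_eqF // !powRr1 // natrD => H.
rewrite truncn_ge_nat // /B ler_pdivlMr //; lra.
Qed.

(** Only finitely many windows compete for a supremum larger than [m n0].  The
    choice of a longest maximiser settles the ties, which merging windows
    produces when [a = 1]. *)
Lemma longest_max_window (n0 n : int) : m n0 < m n ->
  exists (l : int) k, [/\ l <= n, n < l + k%:Z, wsum g l k = m n * k%:R `^ a &
    forall (l' : int) k', l' <= n -> n < l' + k'%:Z ->
      m n * k'%:R `^ a <= wsum g l' k' -> (k' <= k)%N].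
Proof.
move=> n0n.
pose c := (m n0 + m n) / 2.
have n0c : m n0 < c by rewrite /c; lra.
have cn : c < m n by rewrite /c; lra.
have [K K_bound] := near_window_bounded n n0c.
pose P k := `[< exists l : int, [/\ l <= n, n < l + k%:Z &
  m n * k%:R `^ a <= wsum g l k] >].
have P_bound k : P k -> (k <= K)%N.
  move=> /asboolP[l [ln nk mk]]; apply: (K_bound l) => //.
  by apply: le_trans mk; rewrite ler_wpM2r ?powR_ge0 // ltW.
have [|noP] := pselect (exists k, P k).
  move=> exP; have [k /asboolP[l [ln nk mk]] kmax] := ex_maxnP exP P_bound.
  exists l, k; split => //.
  - by apply/eqP; rewrite eq_le mk andbT (window_le gm).
  - by move=> l' k' l'n nk' mk'; apply: kmax; apply/asboolP; exists l'.
have below l k : l <= n -> n < l + k%:Z -> wsum g l k < m n * k%:R `^ a.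
  move=> ln nk; rewrite ltNge; apply/negP => mk; apply: noP.
  by exists k; apply/asboolP; exists l.
(* p stands for the window of length p.1 that starts p.2 points before n *)
pose F (p : 'I_K.+1 * 'I_K.+1) : R :=
  wsum g (n - p.2%:Z) p.1 / p.1%:R `^ a.
pose c' := \big[Num.max/c]_(p : 'I_K.+1 * 'I_K.+1 | (p.2 < p.1)%N) F p.
have c'n : c' < m n.
  apply/bigmax_ltP; split => // -[k i] /= ik.
  rewrite /F /= ltr_pdivrMr ?pow_gt0 ?(leq_ltn_trans _ ik) //.
  apply: below; int_lia.
have [l [k [ln nk ck]]] := window_near gm c'n.
have cc' : c <= c' by exact: bigmax_ge_id.
have kK : (k <= K)%N.
  apply: (K_bound l) => //.
  by apply: le_trans (ltW ck); rewrite ler_wpM2r ?powR_ge0.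
have k0 : (0 < k)%N by int_lia.
have iK : (absz (n - l)%R < K.+1)%N by int_lia.
pose p : 'I_K.+1 * 'I_K.+1 := (inord k, Ordinal iK).
have pE : p.1 = k :> nat by rewrite /= inordK.
have p_in : (p.2 < p.1)%N by rewrite pE /=; int_lia.
have : F p <= c' by exact: (le_bigmax_cond c F p_in).
rewrite /F pE leNgt ltr_pdivlMr ?pow_gt0 //.
have -> : n - p.2%:Z = l by rewrite /=; int_lia.
by rewrite ck.
Qed.

(** If the longest maximal window of [n + 1] stopped at [p < b], merging it with
    a maximal window of [p + 1] would give a longer one of at least the same
    value: the overlap has sum at most [m p j^a <= m (p + 1) j^a], so the [z] new
    points carry at least [m (p + 1) ((j + z)^a - j^a)], which by concavity is
    at least the [m (n + 1) ((k + z)^a - k^a)] needed. *)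
Lemma max_window_reach (n b : int) : m n < m (n + 1) -> n + 1 <= b ->
    (forall i : int, n + 1 <= i -> i < b -> m i <= m (i + 1)) ->
  exists k, [/\ b < n + 1 + k%:Z & wsum g (n + 1) k = m (n + 1) * k%:R `^ a].
Proof.
move=> n_up nb nondec.
have [l [k [ln nk lk_max longest]]] := longest_max_window n_up.
have k0 : (0 < k)%N by int_lia.
have ln1 : l = n + 1.
  apply/eqP; rewrite eq_le ln leNgt; apply/negP => ln'.
  have : wsum g l k <= m n * k%:R `^ a by apply: (window_le gm); int_lia.
  by rewrite lk_max ler_pM2r ?pow_gt0 // leNgt n_up.
subst l; exists k; split => //.
rewrite ltNge; apply/negP => kb.
(* p is the last point of the window *)
pose p : int := n + k%:Z.
have mono (i : int) j : n + 1 <= i -> i + j%:Z <= b -> m i <= m (i + j%:Z).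
  move=> ni; elim: j => [|j IHj] ijb; first by rewrite addr0.
  have -> : i + j.+1%:Z = i + j%:Z + 1 by int_lia.
  by apply: le_trans (IHj _) (nondec _ _ _); int_lia.
have n_le_p1 : m (n + 1) <= m (p + 1).
  have -> : p + 1 = n + 1 + k%:Z by rewrite /p; int_lia.
  apply: mono; int_lia.
have p_le_p1 : m p <= m (p + 1) by apply: nondec; rewrite /p; int_lia.
have p1_up := lt_le_trans n_up n_le_p1.
have [l' [k' [l'p pk' lk'_max _]]] := longest_max_window p1_up.
have [l'n|nl'] := leP l' (n + 1).
  have : (k' <= k)%N.
    apply: longest l'n _ _; first by rewrite /p in pk'; int_lia.
    by rewrite lk'_max ler_wpM2r ?powR_ge0.
  by rewrite /p in pk'; int_lia.
(* j points of the second window lie in the first one, z after it *)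
have [j [z [z0 l'E k'E jk]]] : exists j z : nat,
    [/\ (0 < z)%N, l' + j%:Z = p + 1, k' = (j + z)%N & (j < k)%N].
  exists (absz (p + 1 - l')%R), (absz (l' + k'%:Z - (p + 1))%R).
  rewrite /p in pk' l'p *; split; int_lia.
have j_le : wsum g l' j <= m (p + 1) * j%:R `^ a.
  have [->|j0] := posnP j; first by rewrite wsum0 mulr_ge0 ?powR_ge0.
  apply: le_trans (window_le gm (n := p) _ _) _; [int_lia|int_lia|].
  by rewrite ler_wpM2r ?powR_ge0.
have : (k + z <= k)%N; last by int_lia.
apply: (longest (n + 1)) => //; first by int_lia.
rewrite wsum_cat lk_max.
have -> : n + 1 + k%:Z = p + 1 by rewrite /p; int_lia.
have := lk'_max; rewrite k'E wsum_cat l'E => z_eq.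
have jk_le : j%:R <= k%:R :> R by rewrite ler_nat ltnW.
have := powR_increment_anti a_gt0 a_le1 (ler0n R j) jk_le (ler0n R z).
rewrite -!natrD => incr.
have incr0 : 0 <= (k + z)%:R `^ a - k%:R `^ a :> R.
  by rewrite subr_ge0 ge0_ler_powR ?nnegrE ?ler0n ?ler_nat ?leq_addr // ltW.
have := ler_pM (window_sup_ge0 _) incr0 n_le_p1 incr.
lra.
Qed.
End FractionalSup.

(** * The sum of the powers of the jumps *)

Section PowerVariation.
Context {R : realType} (a V : R) (g m : int -> R).
Hypotheses (a_gt0 : 0 < a) (a_le1 : a <= 1).
Hypothesis g_ge0 : forall n, 0 <= g n.
Hypothesis gm : window_sup a g m.
Hypothesis V_ge0 : 0 <= V.
Hypothesis g_var : forall l k, wsum (increment g) l k <= V.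

Let q := a^-1.

Let q_ge1 : 1 <= q. Proof. by rewrite invf_ge1. Qed.
Let q_gt0 : 0 < q. Proof. exact: lt_le_trans q_ge1. Qed.
Let powD1 k : (0 < k)%N -> k%:R `^ a * k%:R `^ (1 - a) = k%:R :> R.
Proof.
move=> k0; have kR : 0 < k%:R :> R by rewrite ltr0n.
rewrite -powRD; last by apply/implyP => _; rewrite gt_eqF.
by rewrite addrC subrK powRr1 // ltW.
Qed.

Definition rise (n : int) : R := Num.max 0 (m (n + 1) - m n) `^ q.

Lemma rise_ge0 n : 0 <= rise n.
Proof. exact: powR_ge0. Qed.

Lemma rise_eq0 n : m (n + 1) <= m n -> rise n = 0.
Proof.
by move=> down; rewrite /rise max_l ?subr_le0 // powR0 // gt_eqF.
Qed.

(** The window with [n] added has value at most [m n], and a sum of [k] values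
    of [g] near [n] is at most [k (g n + V)]. *)
Lemma jump_window_le (n : int) k : (0 < k)%N ->
    wsum g (n + 1) k = m (n + 1) * k%:R `^ a ->
  (m (n + 1) - m n) * k%:R `^ a <= V.
Proof.
move=> k0 k_max.
set S := wsum g (n + 1) k in k_max.
have kR : 0 < k%:R :> R by rewrite ltr0n.
have S_le : S <= k%:R * (g n + V).
  rewrite -(wsum_const (g n + V) (n + 1)).
  apply: ler_wsum => i ni ik.
  have := dist_le_wsum_increment g n (k := k) (i := absz (i - n)%R) (j := 0).
  have -> : n + (absz (i - n)%R)%:Z = i by int_lia.
  rewrite addr0 => /(_ _ (leq0n _)) H.
  have := g_var n k; have := H ltac:(int_lia); lra.
have mn_ge : g n + S <= m n * k.+1%:R `^ a.
  have <- : wsum g n k.+1 = g n + S by rewrite -add1n wsum_cat wsum1.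
  apply: (window_le gm); int_lia.
have ratio : k%:R * k.+1%:R `^ a <= k.+1%:R * k%:R `^ a :> R.
  rewrite -[in leLHS](powD1 k0) -[in leRHS](powD1 (ltn0Sn k)).
  rewrite mulrAC -mulrA mulrC -mulrA [_ `^ (1 - a) * _]mulrC mulrA.
  rewrite mulrAC ler_wpM2l ?mulr_ge0 ?powR_ge0 //.
  by rewrite ge0_ler_powR ?subr_ge0 ?nnegrE ?ler0n ?ler_nat.
have mn0 : 0 <= m n.
  have := window_le gm (l := n) (k := 1) (lexx n) ltac:(int_lia).
  by rewrite wsum1 powR1 mulr1; apply: le_trans.
have mn_k : k%:R * (g n + S) <= k.+1%:R * (m n * k%:R `^ a).
  apply: le_trans (ler_wpM2l (ltW kR) mn_ge) _.
  by rewrite mulrCA [leRHS]mulrCA ler_wpM2l.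
rewrite mulrBl -k_max.
have := g_ge0 n.
have k1R : k.+1%:R = k%:R + 1 :> R by rewrite -addn1 natrD.
rewrite k1R in mn_k.
have kV : k%:R * V <= (k%:R + 1) * V by rewrite ler_wpM2r // lerDl.
suff : (k%:R + 1) * (S - m n * k%:R `^ a) <= (k%:R + 1) * V.
  by rewrite ler_pM2l // addr_gt0.
lra.
Qed.

(** The factor [D^(q - 1)] of [D^q = D D^(q - 1)] is bounded by
    [jump_window_le], and [a (q - 1) = 1 - a].  The lower bound [K] of the window
    length is what becomes common to all the jumps of a run. *)
Lemma rise_window_le (n : int) k K : (0 < K)%N -> (K <= k)%N -> m n < m (n + 1) ->
    wsum g (n + 1) k = m (n + 1) * k%:R `^ a ->
  rise n * K%:R `^ (1 - a) <= (m (n + 1) - m n) * V `^ (q - 1).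
Proof.
move=> K0 Kk n_up k_max.
have k0 := leq_trans K0 Kk.
have D0 : 0 <= m (n + 1) - m n by rewrite subr_ge0 ltW.
rewrite /rise max_r //.
rewrite -mulr_powRB1 // -mulrA ler_wpM2l //.
have q1 : 0 <= q - 1 by rewrite subr_ge0.
have -> : K%:R `^ (1 - a) = (K%:R `^ a) `^ (q - 1) :> R.
  by rewrite -powRrM mulrBr mulr1 mulfV ?gt_eqF.
rewrite -powRM ?powR_ge0 // ge0_ler_powR ?nnegrE ?mulr_ge0 ?powR_ge0 //.
apply: le_trans (jump_window_le k0 k_max).
by rewrite ler_wpM2l // ge0_ler_powR ?nnegrE ?ler0n ?ler_nat // ltW.
Qed.

(** All the jumps of a run share the window length [K] of its last jump as a
    lower bound, so the factor [K^(1 - a)] leaves a telescoping sum; the average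
    of [g] over the last window and the minimum of [g] on the run then turn it
    into an oscillation of [g] on the run. *)
Lemma rise_run_le (x : int) t :
    (forall i : int, x <= i -> i < x + t%:Z -> m i <= m (i + 1)) ->
    m (x + t%:Z + 1) < m (x + t%:Z) ->
  wsum rise x t <= V `^ (q - 1) * wsum (increment g) x t.
Proof.
move=> nondec drop; set b : int := x + t%:Z in nondec drop *.
have mono (i j : int) : x <= i -> i <= j -> j <= b -> m i <= m j.
  move=> xi ij jb; have -> : j = i + (absz (j - i)%R)%:Z by int_lia.
  have : i + (absz (j - i)%R)%:Z <= b by int_lia.
  elim: absz => [|d IHd] db; first by rewrite addr0.
  have -> : i + d.+1%:Z = i + d%:Z + 1 by int_lia.
  by apply: le_trans (IHd _) (nondec _ _ _); int_lia.
have VD0 : 0 <= V `^ (q - 1) * wsum (increment g) x t.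
  by rewrite mulr_ge0 ?powR_ge0 // wsum_ge0 // => n; exact: increment_ge0.
pose P d := (d < t)%N && (m (x + d%:Z) < m (x + d%:Z + 1)).
have [|noP] := pselect (exists d, P d); last first.
  rewrite (@eq_wsum _ _ (fun=> 0)) ?wsum_const ?mulr0 // => n xn nb.
  apply: rise_eq0; rewrite leNgt; apply/negP => n_up; apply: noP.
  exists (absz (n - x)%R); rewrite /P.
  by have -> : x + (absz (n - x)%R)%:Z = n; [int_lia | rewrite n_up andbT; int_lia].
move=> exP; have P_bound d : P d -> (d <= t)%N by move=> /andP[/ltnW].
(* the last jump of the run *)
have [d /andP[dt d_up] d_max] := ex_maxnP exP P_bound.
set n : int := x + d%:Z in d_up.
have c_b : m (n + 1) = m b.
  have : n + 1 <= b by rewrite /n /b; int_lia.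
  have -> : b = n + 1 + (absz (b - (n + 1))%R)%:Z by rewrite /n /b; int_lia.
  have : n + 1 + (absz (b - (n + 1))%R)%:Z <= b by rewrite /n /b; int_lia.
  elim: absz => [|e IHe] eb nb; first by rewrite addr0.
  rewrite IHe; [|int_lia|int_lia].
  have -> : n + 1 + e.+1%:Z = n + 1 + e%:Z + 1 by int_lia.
  apply/eqP; rewrite eq_le nondec ?andTb; [|rewrite /n; int_lia|int_lia].
  rewrite leNgt; apply/negP => up.
  have : P (d + 1 + e)%N.
    rewrite /P; have -> : x + (d + 1 + e)%N%:Z = n + 1 + e%:Z by rewrite /n; int_lia.
    by rewrite up andbT; rewrite /n /b in eb; int_lia.
  by move=> /d_max; int_lia.
have nondec' (i : int) : n + 1 <= i -> i < b -> m i <= m (i + 1).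
  by move=> ni ib; apply: nondec => //; rewrite /n in ni; int_lia.
have nb : n + 1 <= b by rewrite /n /b; int_lia.
have [K [bK K_max]] := max_window_reach a_gt0 a_le1 g_ge0 gm d_up nb nondec'.
have K0 : (0 < K)%N by int_lia.
(* a window containing b + 1 has value at most m (b + 1) < m b *)
have KE : n + 1 + K%:Z = b + 1.
  apply/eqP; rewrite eq_le; apply/andP; split; last by int_lia.
  rewrite leNgt; apply/negP => bK'.
  have : wsum g (n + 1) K <= m (b + 1) * K%:R `^ a.
    by apply: (window_le gm); int_lia.
  by rewrite K_max c_b ler_pM2r ?powR_gt0 ?ltr0n // leNgt drop.
have rise_le (i : int) : x <= i -> i < x + t%:Z ->
    rise i * K%:R `^ (1 - a) <= V `^ (q - 1) * (m (i + 1) - m i).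
  move=> xi it; have [i_up|i_down] := ltP (m i) (m (i + 1)); last first.
    rewrite rise_eq0 // mul0r mulr_ge0 ?powR_ge0 // subr_ge0 nondec //.
  have i_n : i <= n.
    rewrite leNgt; apply/negP => ni.
    have : P (absz (i - x)%R).
      rewrite /P; have -> : x + (absz (i - x)%R)%:Z = i by int_lia.
      by rewrite i_up andbT; int_lia.
    by move=> /d_max; rewrite /n in ni; int_lia.
  have ib : i + 1 <= b by int_lia.
  have nondec_i (j : int) : i + 1 <= j -> j < b -> m j <= m (j + 1).
    by move=> ij jb; apply: nondec => //; int_lia.
  have [k [bk k_max]] := max_window_reach a_gt0 a_le1 g_ge0 gm i_up ib nondec_i.
  rewrite [leRHS]mulrC; apply: rise_window_le k_max => //; int_lia.
have sum_le : wsum rise x t * K%:R `^ (1 - a) <= V `^ (q - 1) * (m b - m x).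
  rewrite -wsum_telescope -wsumZ mulrC -wsumZ.
  by apply: ler_wsum => i xi it; rewrite mulrC; exact: rise_le.
have KR : 0 < K%:R `^ (1 - a) :> R by rewrite powR_gt0 // ltr0n.
rewrite -(ler_pM2r KR); apply: le_trans sum_le _.
rewrite -mulrA ler_wpM2l ?powR_ge0 //.
set D := wsum (increment g) x t.
pose j := [arg min_(i < (ord0 : 'I_t.+1)) g (x + i%:Z)]%O.
pose mu := g (x + j%:Z).
have mu0 : 0 <= mu by exact: g_ge0.
have mu_le (i : int) : x <= i -> i <= b -> mu <= g i.
  move=> xi ib; rewrite /mu /j; case: arg_minP => // j' _ j'_min.
  have it : (absz (i - x)%R < t.+1)%N by int_lia.
  have := j'_min (Ordinal it) isT.
  by have -> : x + (Ordinal it)%:Z = i by rewrite /=; int_lia.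
have le_mu (i : int) : x <= i -> i <= b -> g i <= mu + D.
  move=> xi ib.
  have jt : (j <= t)%N by rewrite -ltnS.
  have it : (absz (i - x)%R <= t)%N by int_lia.
  have := dist_le_wsum_increment g x it jt.
  have -> : x + (absz (i - x)%R)%:Z = i by int_lia.
  rewrite -/mu -/D; lra.
have mb_le : m b <= (mu + D) * K%:R `^ (1 - a).
  have Ka : 0 < K%:R `^ a :> R by rewrite powR_gt0 // ltr0n.
  rewrite -(ler_pM2r Ka) -mulrA [_ `^ (1 - a) * _]mulrC powD1 // -c_b -K_max.
  rewrite mulrC -(wsum_const (mu + D) (n + 1)).
  by apply: ler_wsum => i ni iK; apply: le_mu; rewrite /n in ni; int_lia.
have mx_ge : mu * K%:R `^ (1 - a) <= m x.
  have ta : 0 < t.+1%:R `^ a :> R by rewrite powR_gt0 // ltr0n.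
  have Kt : K%:R `^ (1 - a) <= t.+1%:R `^ (1 - a) :> R.
    rewrite ge0_ler_powR ?subr_ge0 ?nnegrE ?ler0n // ler_nat.
    by rewrite /n in KE; int_lia.
  apply: le_trans (ler_wpM2l mu0 Kt) _.
  rewrite -(ler_pM2r ta) -mulrA [_ `^ (1 - a) * _]mulrC powD1 //.
  have : wsum g x t.+1 <= m x * t.+1%:R `^ a by apply: (window_le gm); int_lia.
  apply: le_trans; rewrite mulrC -(wsum_const mu x).
  by apply: ler_wsum => i xi it; apply: mu_le; rewrite /b; int_lia.
lra.
Qed.

(** Cutting at the first drop after [x] splits off one run; the drop itself is
    no jump.  The variation is taken over a window that may be longer than the
    one of the sum, because the last run met by the sum is completed. *)
Lemma sum_rise_le (x : int) t :
  exists z, wsum rise x t <= V `^ (q - 1) * wsum (increment g) x z.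
Proof.
elim/ltn_ind: t x => t IHt x.
pose P j := m (x + j%:Z + 1) < m (x + j%:Z).
have [exP|noP] := pselect (exists j, P j); last first.
  exists 0%N; rewrite wsum0 mulr0 (@eq_wsum _ _ (fun=> 0)) ?wsum_const ?mulr0 //.
  have nondec (i : int) : x <= i -> m i <= m (i + 1).
    move=> xi; rewrite leNgt; apply/negP => i_down; apply: noP.
    exists (absz (i - x)%R); rewrite /P.
    by have -> : x + (absz (i - x)%R)%:Z = i by int_lia.
  move=> n xn _; apply: rise_eq0; rewrite leNgt; apply/negP => n_up.
  have [_ [k0 [_ _ _ k0_max]]] := longest_max_window a_gt0 g_ge0 gm n_up.
  (* no window maximal at n + 1 reaches n + 1 + k0 *)
  have [k [bk k_max]] := @max_window_reach _ a g m a_gt0 a_le1 g_ge0 gm n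
     (n + 1 + k0%:Z) n_up ltac:(int_lia) (fun i ni _ => nondec i ltac:(int_lia)).
  have := k0_max (n + 1) k (lexx _) ltac:(int_lia) ltac:(by rewrite k_max).
  int_lia.
have [j j_drop j_min] := ex_minnP exP.
have run : wsum rise x j <= V `^ (q - 1) * wsum (increment g) x j.
  apply: rise_run_le => // i xi ij; rewrite leNgt; apply/negP => i_down.
  have : P (absz (i - x)%R).
    by rewrite /P; have -> : x + (absz (i - x)%R)%:Z = i by int_lia.
  by move=> /j_min; int_lia.
have [tj|jt] := leqP t j.
  exists j; apply: le_trans run; apply: wsum_sub => //; last by int_lia.
  exact: rise_ge0.
have [z z_le] := IHt (t - j.+1)%N ltac:(int_lia) (x + j%:Z + 1).
exists (j + (1 + z))%N.
have -> : t = (j + (1 + (t - j.+1)))%N by int_lia.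
rewrite !wsum_cat !wsum1 (rise_eq0 (ltW j_drop)).
have := increment_ge0 g (x + j%:Z) => d0.
have : 0 <= V `^ (q - 1) * increment g (x + j%:Z) by rewrite mulr_ge0 ?powR_ge0.
have -> : x + j%:Z + 1%N%:Z = x + j%:Z + 1 by [].
lra.
Qed.

Lemma sum_rise_le_power x t : wsum rise x t <= V `^ q.
Proof.
have [z z_le] := sum_rise_le (x : int) t.
apply: le_trans z_le _.
by rewrite -(mulr_powRB1 V_ge0 q_gt0) mulrC ler_wpM2r ?powR_ge0.
Qed.

End PowerVariation.

(** The increasing steps of [m] are handled directly and the decreasing ones as
    the increasing steps of the reflected function. *)
Lemma sum_power_variation_le {R : realType} (a V : R) (g m : int -> R) :
    0 < a -> a <= 1 -> (forall n, 0 <= g n) -> window_sup a g m -> 0 <= V ->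
    (forall l k, wsum (increment g) l k <= V) ->
  forall x t, wsum (fun n => `|m (n + 1) - m n| `^ a^-1) x t <= V `^ a^-1 *+ 2.
Proof.
move=> a0 a1 g0 gm V0 gV x t.
pose g' n := g (- n); pose m' n := m (- n).
have g'V l k : wsum (increment g') l k <= V.
  apply: le_trans (gV (- l - k%:Z) k).
  have -> : - l - k%:Z = 1 - (l + 1) - k%:Z by int_lia.
  rewrite -wsum_reflect /wsum; apply: ler_sum => i _.
  rewrite /increment /g' distrC.
  have -> : - (l + 1 + i%:Z) = - (l + i%:Z + 1) by int_lia.
  by have -> : - (l + i%:Z + 1) + 1 = - (l + i%:Z) by int_lia.
have rises := sum_rise_le_power a0 a1 g0 gm V0 gV x t.
have falls := sum_rise_le_power (a := a) (g := g') (m := m') a0 a1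
  (fun n => g0 _) (window_sup_reflect gm) V0 g'V (- x - t%:Z) t.
rewrite mulr2n; apply: le_trans (lerD rises falls).
have -> : - x - t%:Z = 1 - (x + 1) - t%:Z by int_lia.
rewrite -wsum_reflect /wsum -big_split /=; apply: ler_sum => i _.
rewrite /rise /m'.
have -> : - (- (x + 1 + i%:Z) + 1) = x + i%:Z by int_lia.
have -> : - (- (x + 1 + i%:Z)) = x + i%:Z + 1 by int_lia.
set u := m _; set v := m _.
have q0 : a^-1 != 0 by rewrite invr_eq0 gt_eqF.
have [uv|vu] := leP u v.
- have uv0 : u - v <= 0 by rewrite subr_le0.
  have vu0 : 0 <= v - u by rewrite subr_ge0.
  by rewrite (max_l uv0) (max_r vu0) powR0 // add0r distrC ger0_norm.
- have uv0 : 0 <= u - v by rewrite subr_ge0 ltW.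
  have vu0 : v - u <= 0 by rewrite subr_le0 ltW.
  by rewrite (max_r uv0) (max_l vu0) powR0 // addr0 ger0_norm.
Qed.

(** * Sums over all integers *)

Section IntegerSums.
Context {R : realType} (h : int -> R).
Hypothesis h_ge0 : forall n, 0 <= h n.
Local Open Scope classical_set_scope.

Let window (l : int) k : seq int := [seq l + i%:Z | i <- iota 0 k].

Let fsum_window l k :
  (\sum_(n \in [set` window l k]) (h n)%:E)%E = (wsum h l k)%:E.
Proof.
rewrite -fsbig_seq; last first.
  by rewrite map_inj_uniq ?iota_uniq // => i j /addrI [].
by rewrite big_map -[k in iota 0 k]subn0 big_mkord sumEFin.
Qed.

Lemma wsum_le_esum l k : ((wsum h l k)%:E <= \esum_(n in [set: int]) (h n)%:E)%E.
Proof.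
apply: esum_ge; exists [set` window l k]; last by rewrite fsum_window.
by split => //; exact: finite_seq.
Qed.

Lemma esum_le_wsum (c : R) : (forall l k, wsum h l k <= c) ->
  (\esum_(n in [set: int]) (h n)%:E <= c%:E)%E.
Proof.
move=> hc; apply: ge_ereal_sup => _ [X [finX _] <-].
have [s Xs] := (finite_seqP X).1 finX.
pose N := \max_(n <- s) absz n.
apply: (@le_trans _ _ (wsum h (- N%:Z) (N + N).+1)%:E); last by rewrite lee_fin.
rewrite -fsum_window; apply: lee_fsum_nneg_subset => //.
- exact: finite_seq.
- move=> n; rewrite !inE Xs /= => ns.
  have : (absz n <= N)%N by apply: (leq_bigmax_seq (F := absz)) => //.
  move=> nN; apply/mapP; exists (absz (n + N%:Z)%R); last by int_lia.
  by rewrite mem_iota; int_lia.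
- by move=> n _; rewrite lee_fin.
Qed.

End IntegerSums.

(** * Finiteness of the maximal function *)

Section FracMaximal.
Context {R : realType} (beta : R) (f : int -> R).
Hypothesis beta_lt1 : beta < 1.

Let g n := `|f n|.

Lemma frac_averageE n r s : frac_average beta f n r s =
  wsum g (n - r%:Z) (r + s).+1 / (r + s).+1%:R `^ (1 - beta).
Proof.
by congr (_ / _); apply: eq_bigr => i _; rewrite /g; congr `|f _|; int_lia.
Qed.

Lemma window_frac_average (l : int) k (n : int) : l <= n -> n < l + k%:Z ->
  exists r s, frac_average beta f n r s = wsum g l k / k%:R `^ (1 - beta).
Proof.
move=> ln nk; exists (absz (n - l)%R), (absz (l + k%:Z - n - 1)%R).
rewrite frac_averageE.
have -> : ((absz (n - l)%R + absz (l + k%:Z - n - 1)%R).+1 = k)%N by int_lia.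
by have -> : n - (absz (n - l)%R)%:Z = l by int_lia.
Qed.

Lemma frac_maximal_window (l : int) k (n : int) : l <= n -> n < l + k%:Z ->
  ((wsum g l k / k%:R `^ (1 - beta))%:E <= frac_maximal beta f n)%E.
Proof.
move=> ln nk; have [r [s <-]] := window_frac_average ln nk.
by apply: ereal_sup_ubound; exists (r, s).
Qed.

Lemma frac_maximal_ge0 n : (0 <= frac_maximal beta f n)%E.
Proof.
apply: le_trans (frac_maximal_window (l := n) (k := 1) (lexx n) _); last by int_lia.
by rewrite lee_fin divr_ge0 ?powR_ge0 // wsum_ge0 // => i; exact: normr_ge0.
Qed.

(** Extending a window of length [k] by [d] points to reach [n0] multiplies its
    length by at most [d + 1], so every value at [n] is at most [(d + 1)^a] times
    the maximal function at [n0]. *)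
Lemma frac_maximal_fin_num (n0 n : int) : frac_maximal beta f n0 != +oo%E ->
  frac_maximal beta f n \is a fin_num.
Proof.
move=> n0_fin.
have M0 : frac_maximal beta f n0 \is a fin_num.
  by rewrite ge0_fin_numE ?frac_maximal_ge0 // ltey.
set C := fine (frac_maximal beta f n0).
have C0 : 0 <= C by rewrite fine_ge0 // frac_maximal_ge0.
pose d := absz (n - n0)%R.
rewrite ge0_fin_numE ?frac_maximal_ge0 //.
apply: (@le_lt_trans _ _ (C * d.+1%:R `^ (1 - beta))%:E); last exact: ltry.
apply: ge_ereal_sup => _ [[r s] _ <-] /=.
rewrite lee_fin frac_averageE ler_pdivrMr ?powR_gt0 ?ltr0n //.
set k := (r + s).+1; set l := n - r%:Z.
have [ln nk] : l <= n /\ n < l + k%:Z by rewrite /l /k; split; int_lia.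
have [l' [l'l l'n n0k lk]] := extend_window n0 ln nk.
have ext_le : wsum g l k <= C * (k + d)%:R `^ (1 - beta).
  apply: (@le_trans _ _ (wsum g l' (k + d))).
    by apply: wsum_sub => // i; exact: normr_ge0.
  have := frac_maximal_window l'n n0k.
  by rewrite -(fineK M0) -/C lee_fin ler_pdivrMr // powR_gt0 // ltr0n.
apply: le_trans ext_le _.
rewrite -mulrA -powRM ?ler0n // ler_wpM2l // ge0_ler_powR ?nnegrE ?mulr_ge0 //.
  by rewrite subr_ge0 ltW.
by rewrite -natrM ler_nat mulSn leq_add2l leq_pmulr.
Qed.

Lemma frac_maximal_window_sup : (forall n, frac_maximal beta f n \is a fin_num) ->
  window_sup (1 - beta) g (fun n => fine (frac_maximal beta f n)).
Proof.
move=> fin; split=> [l k n ln nk|n c].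
  have k0 : (0 < k)%N by int_lia.
  have := frac_maximal_window ln nk.
  by rewrite -(fineK (fin n)) lee_fin ler_pdivrMr // powR_gt0 // ltr0n.
rewrite -lte_fin fineK // => /ereal_sup_gt[_ [[r s] _ <-]] /=.
rewrite lte_fin frac_averageE ltr_pdivlMr ?powR_gt0 ?ltr0n // => cS.
exists (n - r%:Z), (r + s).+1; split => //; int_lia.
Qed.

End FracMaximal.

(** * The norm inequality *)

Unset Implicit Arguments.

Theorem theorem2 (R : realType) (beta q : R) (f : int -> R)
    (hbeta0 : 0 <= beta) (hbeta1 : beta < 1) (hq : q = 1 / (1 - beta))
    (hf : bounded_variationZ f)
    (hM : ~ (forall n : int, frac_maximal beta f n = +oo%E)) :
  (lp_norm q (discrete_deriv (frac_maximal beta f))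
     <= (4 `^ (1 / q))%:E * lp_norm 1 (discrete_deriv (EFin \o f)))%E.
Proof.
have a0 : 0 < 1 - beta by rewrite subr_gt0.
have a1 : 1 - beta <= 1 by rewrite gerBl.
have qE : q = (1 - beta)^-1 by rewrite hq div1r.
have q0 : 0 < q by rewrite qE invr_gt0.
have [n0 n0_fin] : exists n0, frac_maximal beta f n0 != +oo%E.
  apply: contrapT => H; apply: hM => n; apply/eqP/negPn/negP => nfin.
  by apply: H; exists n.
have fin n := frac_maximal_fin_num hbeta1 n n0_fin.
have gm := frac_maximal_window_sup fin.
set m := fun n : int => fine _ in gm.
have normE : lp_norm 1 (discrete_deriv (EFin \o f)) =
    (\esum_(n in [set: int]) (increment f n)%:E)%E.
  rewrite /lp_norm invr1 poweRe1; last by apply: esum_ge0 => n _; exact: poweR_ge0.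
  by apply: eq_esum => n _; rewrite poweRe1 ?abse_ge0.
move: hf; rewrite /bounded_variationZ normE => V_lty.
have V_fin : (\esum_(n in [set: int]) (increment f n)%:E)%E \is a fin_num.
  by rewrite ge0_fin_numE // esum_ge0 // => n _; rewrite lee_fin increment_ge0.
pose V := fine (\esum_(n in [set: int]) (increment f n)%:E)%E.
rewrite -(fineK V_fin) -/V.
have fV l k : wsum (increment f) l k <= V.
  rewrite -lee_fin /V fineK //; apply: wsum_le_esum; exact: increment_ge0.
have V0 : 0 <= V by apply: le_trans (fV 0 0%N); rewrite wsum0.
have gV l k : wsum (increment (fun n => `|f n|)) l k <= V.
  apply: le_trans (fV l k); apply: ler_wsum => n _ _; exact: ler_dist_dist.
have pow_sum := sum_power_variation_le a0 a1 (fun n => normr_ge0 (f n)) gm V0 gV.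
rewrite -qE in pow_sum.
have derivE n : (`|discrete_deriv (frac_maximal beta f) n| `^ q =
    (`|m (n + 1) - m n| `^ q)%:E)%E.
  by rewrite /discrete_deriv -(fineK (fin n)) -(fineK (fin (n + 1))).
have := esum_le_wsum (fun n => powR_ge0 _ q) pow_sum.
rewrite /lp_norm [X in (_ -> poweR X _ <= _)%E](eq_esum (fun n _ => derivE n)).
set E := (\esum_(_ in _) _)%E => E_le.
have E0 : (0 <= E)%E by apply: esum_ge0 => n _; rewrite lee_fin powR_ge0.
have E_le4 : (E <= (4 * V `^ q)%:E)%E.
  apply: le_trans E_le _; rewrite lee_fin -mulr_natl ler_wpM2r ?powR_ge0 //.
  by rewrite ler_nat.
have qV0 : 0 <= q^-1 by rewrite invr_ge0 ltW.
have := gt0_ler_poweR qV0 _ _ E_le4.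
rewrite !in_itv /= E0 leey lee_fin mulr_ge0 ?powR_ge0 ?leey // => /(_ isT isT).
move=> /le_trans; apply; rewrite lee_fin powRM ?powR_ge0 // -powRrM mulfV ?gt_eqF //.
by rewrite powRr1 // div1r.
Qed.
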